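(* Let $n$ be even and let $M\in\mathbb{R}^{n\times n}$ be a nonzero skew-symmetric matrix with spectral radius $\rho(M)$. Let $\varrho^{\rm worst}_{\rm FP}$ be the worst-case root-convergence factor of the fixed-point residual iteration $\mathbf{r}_{k+1}=M\mathbf{r}_k$, $k=0,1,\dots$, and let $\varrho^{\rm worst}_{\rm AA}$ be the worst-case root-convergence factor of the associated rAA(1) residual iteration. Then $$\varrho^{\rm worst}_{\rm AA}=\frac{\rho(M)}{\big[1+\rho(M)^2\big]^{1/4}}<\rho(M)=\varrho^{\rm worst}_{\rm FP}.$$ As such, the rAA(1) iteration converges (i.e. $\mathbf{r}_k\to\mathbf{0}$) for arbitrary $\mathbf{r}_0\in\mathbb{R}^n$ if and only if $$\rho(M)<\sqrt{\tfrac12\big(1+\sqrt5\big)}.$$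
   Context: Let $\langle\cdot,\cdot\rangle$ be the Euclidean inner product and $\|\cdot\|$ the $\ell^2$-norm. Put $A:=I-M$ (invertible since $M$ is skew symmetric) and define for $\mathbf{v}\neq\mathbf{0}$ $$\alpha(\mathbf{v}):=\frac{\langle A\mathbf{v},\mathbf{v}\rangle}{\langle A\mathbf{v},A\mathbf{v}\rangle},\qquad \mathcal{R}(\mathbf{v}):=M\,[I-\alpha(\mathbf{v})A]\,\mathbf{v}.$$ The rAA(1) residual iteration (restarted Anderson acceleration with restart size one for $\mathbf{x}\mapsto M\mathbf{x}+\mathbf{b}$) started from $\mathbf{r}_0$ generates $\mathbf{r}_1,\mathbf{r}_2,\dots$ by $\mathbf{r}_{k+1}=M\mathbf{r}_k$ for $k=0,2,4,\dots$ and $\mathbf{r}_{k+1}=\mathcal{R}(\mathbf{r}_{k-1})$ for $k=1,3,5,\dots$. If some even-indexed residual is $\mathbf{0}$, the exact solution has been found, the iteration is halted, and all subsequent residuals are taken to be $\mathbf{0}$. For an iteration producing residuals $\mathbf{r}_k$ from $\mathbf{r}_0$, the root-convergence factor is $\varrho(\mathbf{r}_0):=\limsup_{k\to\infty}\|\mathbf{r}_k\|^{1/k}$ (used here whether or not $\mathbf{r}_k\to\mathbf{0}$), and the worst-case root-convergence factor is $\varrho^{\rm worst}:=\max_{\mathbf{r}_0\in\mathbb{R}^n\setminus\{\mathbf{0}\}}\varrho(\mathbf{r}_0)$. *)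

(* Defs.v *)
From mathcomp Require Export all_boot all_order all_algebra.
From mathcomp Require Export all_classical all_reals all_analysis.
From mathcomp.real_closed Require Export complex.
Set Implicit Arguments.
Unset Strict Implicit.
Unset Printing Implicit Defensive.
Export Order.TTheory GRing.Theory Num.Theory.
Export numFieldNormedType.Exports.
Local Open Scope classical_set_scope.
Local Open Scope ring_scope.

Definition dot (R : realType) (n : nat) (u v : 'cV[R]_n) : R :=
  \sum_(i < n) u i 0 * v i 0.

(* The norm `|_| that the library puts on matrices is the sup norm. *)
Definition l2norm (R : realType) (n : nat) (v : 'cV[R]_n) : R :=
  Num.sqrt (dot v v).

(* [sup] is only meaningful on nonempty bounded sets of reals; the spectrum is
   finite, and nonempty as soon as 0 < n. *)
Definition spectral_radius (R : realType) (n : nat) (M : 'M[R]_n) : R :=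
  sup [set ComplexField.Normc.normc l | l in
        [set l : R[i] | eigenvalue (map_mx (real_complex R) M) l]].

Definition fp_residual (R : realType) (n : nat) (M : 'M[R]_n) (r0 : 'cV[R]_n)
  (k : nat) : 'cV[R]_n := iter k (mulmx M) r0.

Definition aa_alpha (R : realType) (n : nat) (M : 'M[R]_n) (v : 'cV[R]_n) : R :=
  let A := 1%:M - M in dot (A *m v) v / dot (A *m v) (A *m v).

(* The test [v == 0] is the halting rule: once an even-indexed residual
   vanishes, so do all the later ones. *)
Definition aa_step (R : realType) (n : nat) (M : 'M[R]_n) (v : 'cV[R]_n) :
    'cV[R]_n :=
  if v == 0 then 0
  else M *m (1%:M - aa_alpha M v *: (1%:M - M)) *m v.

Fixpoint aa_residual (R : realType) (n : nat) (M : 'M[R]_n) (r0 : 'cV[R]_n)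
    (k : nat) : 'cV[R]_n :=
  match k with
  | 0 => r0
  | k1.+1 =>
      match k1 with
      | 0 => M *m r0
      | k0.+1 => if odd k1 then aa_step M (aa_residual M r0 k0)
                 else M *m aa_residual M r0 k1
      end
  end.

(* The term k = 0 has exponent 0^-1 = 0, hence value 1; it does not affect the
   limit superior. For 0 < k, 0 `^ k%:R^-1 = 0. *)
Definition root_factor (R : realType) (n : nat) (r : nat -> 'cV[R]_n) : \bar R :=
  limn_esup (fun k : nat => (l2norm (r k) `^ (k%:R^-1))%:E).

(* [w] is the maximum, attained, of the root-convergence factors over all
   nonzero starting vectors. *)
Definition is_worst_factor (R : realType) (n : nat)
    (res : 'cV[R]_n -> nat -> 'cV[R]_n) (w : \bar R) : Prop :=
  let factors := [set root_factor (res r0) | r0 in [set r0 | r0 != 0]] in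
  factors w /\ ubound factors w.

(* Main.v *)
Require Import Defs.
From mathcomp Require Import spectral ring lra.
Set Implicit Arguments.
Unset Strict Implicit.
Unset Printing Implicit Defensive.
Local Open Scope classical_set_scope.
Local Open Scope ring_scope.
Local Open Scope sesquilinear_scope.

(** Since M is skew-symmetric, <Mv, v> = 0, so A = I - M satisfies
    <Av, v> = |v|^2 and |Av|^2 = |v|^2 + |Mv|^2. With u = |v|^2, p = |Mv|^2 and
    q = |M^2 v|^2 this makes alpha(v) = u / (u + p), and the vector produced by
    two consecutive steps is the combination (p Mv + u M^2 v) / (u + p) of two
    orthogonal vectors; its squared norm is (p^3 + u^2 q) / (u + p)^2
    ([dot_aa_step]).

    Write rho for the spectral radius and s = rho^2. Then p <= s u and
    q <= s p, and under these constraints the ratio above is at most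
    s^2 / (1 + s) * u ([aa_ratio_le]), with equality when p = s u and
    q = s p ([aa_ratio_top]). Hence two steps multiply the norm by at most g^2,
    where g = rho / (1 + rho^2)^(1/4).

    Equality persists for ever on the real space of the v with
    M^2 v = - rho^2 v, because a double step is a combination of Mv and M^2 v
    and so stays in that space. The space is nonzero, and |Mv| <= rho |v|
    holds for all v, by the unitary diagonalization of M over the complex
    numbers ([spectral_radius_top_eigen]). So |r_k| <= C |r_0| g^k for every
    start while |r_k| >= |r_0| g^k for some nonzero start. This two-sided
    bound gives both the worst-case factor ([worst_factor_geometric]) and the
    convergence criterion g < 1 ([geometric_cvg0_iff]), which amounts to
    s^2 < 1 + s, that is, to s being below the golden ratio. The fixed-point
    iteration is treated in the same way, with g = rho. *)

(** * The Euclidean inner product *)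

Lemma dotE (R : realType) n (u v : 'cV[R]_n) : dot u v = (u^T *m v) 0 0.
Proof. by rewrite mxE; apply: eq_bigr => i _; rewrite mxE. Qed.

Lemma dotC (R : realType) n (u v : 'cV[R]_n) : dot u v = dot v u.
Proof. by apply: eq_bigr => i _; rewrite mulrC. Qed.

Lemma dotDl (R : realType) n (u v w : 'cV[R]_n) :
  dot (u + v) w = dot u w + dot v w.
Proof. by rewrite -big_split; apply: eq_bigr => i _; rewrite mxE mulrDl. Qed.

Lemma dotZl (R : realType) n (c : R) (u v : 'cV[R]_n) :
  dot (c *: u) v = c * dot u v.
Proof. by rewrite mulr_sumr; apply: eq_bigr => i _; rewrite mxE mulrA. Qed.

Lemma dotDr (R : realType) n (u v w : 'cV[R]_n) :
  dot u (v + w) = dot u v + dot u w.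
Proof. by rewrite dotC dotDl !(dotC u). Qed.

Lemma dotZr (R : realType) n (c : R) (u v : 'cV[R]_n) :
  dot u (c *: v) = c * dot u v.
Proof. by rewrite dotC dotZl dotC. Qed.

Lemma dot_ge0 (R : realType) n (u : 'cV[R]_n) : 0 <= dot u u.
Proof. by apply: sumr_ge0 => i _; rewrite -expr2 sqr_ge0. Qed.

Lemma dot_eq0 (R : realType) n (u : 'cV[R]_n) : (dot u u == 0) = (u == 0).
Proof.
apply/eqP/eqP => [h|->]; last by apply: big1 => i _; rewrite mxE mul0r.
apply/matrixP => i j; rewrite ord1 mxE.
have u2_ge0 k : true -> 0 <= u k 0 * u k 0 by rewrite -expr2 sqr_ge0.
by apply/eqP; rewrite -sqrf_eq0 expr2 (psumr_eq0P u2_ge0 h).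
Qed.

Lemma dot0 (R : realType) n : dot (0 : 'cV[R]_n) 0 = 0.
Proof. by apply/eqP; rewrite (dot_eq0 (0 : 'cV[R]_n)). Qed.

Lemma dot_gt0 (R : realType) n (u : 'cV[R]_n) : u != 0 -> 0 < dot u u.
Proof. by rewrite lt_def dot_eq0 dot_ge0 andbT. Qed.

Lemma sqr_l2norm (R : realType) n (u : 'cV[R]_n) : l2norm u ^+ 2 = dot u u.
Proof. by rewrite sqr_sqrtr // dot_ge0. Qed.

Lemma l2norm_gt0 (R : realType) n (u : 'cV[R]_n) : u != 0 -> 0 < l2norm u.
Proof. by rewrite sqrtr_gt0; apply: dot_gt0. Qed.

Lemma ler_l2norm (R : realType) n (c : R) (u v : 'cV[R]_n) : 0 <= c ->
  dot u u <= c ^+ 2 * dot v v -> l2norm u <= c * l2norm v.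
Proof.
move=> c0 h; rewrite -(@ler_pXn2r _ 2) ?nnegrE ?mulr_ge0 ?sqrtr_ge0 //.
by rewrite exprMn !sqr_l2norm.
Qed.

Lemma eq_l2norm (R : realType) n (c : R) (u v : 'cV[R]_n) : 0 <= c ->
  dot u u = c ^+ 2 * dot v v -> l2norm u = c * l2norm v.
Proof.
by move=> c0 h; rewrite /l2norm h sqrtrM ?sqr_ge0 // sqrtr_sqr ger0_norm.
Qed.

(** * The spectrum of a skew-symmetric matrix *)

Lemma dot_skew (R : realType) (n : nat) (M : 'M[R]_n)
    (M_skew : M^T = - M) (u v : 'cV[R]_n) : dot (M *m u) v = - dot u (M *m v).
Proof. by rewrite !dotE trmx_mul M_skew mulmxN mulNmx mulmxA mxE. Qed.

Lemma dot_skew0 (R : realType) (n : nat) (M : 'M[R]_n)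
    (M_skew : M^T = - M) (u : 'cV[R]_n) : dot (M *m u) u = 0.
Proof. by have := dot_skew M_skew u u; rewrite (dotC u); lra. Qed.

(** An eigenvalue x + iy of M is purely imaginary, so its square is the real
    number - y^2; the real and imaginary parts of an eigenvector are then
    eigenvectors of the real matrix M^2, and one of them is nonzero. *)
Lemma skew_eigen (R : realType) (n : nat) (M : 'M[R]_n)
    (M_skew : M^T = - M) (l : R[i]) :
  eigenvalue (map_mx (real_complex R) M) l ->
  exists2 v : 'cV[R]_n, v != 0 &
    M *m (M *m v) = - ComplexField.Normc.normc l ^+ 2 *: v.
Proof.
case: l => x y /eigenvalueP [w wM w0].
have [a [b wE]] : exists a b : 'cV[R]_n,
    forall i, w 0 i = Complex (a i 0) (b i 0).
  exists (\col_i complex.Re (w 0 i)), (\col_i complex.Im (w 0 i)) => i.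
  by rewrite !mxE; case: (w 0 i).
have wME (i : 'I_n) :
    \sum_j w 0 j * real_complex R (M j i) = Complex x y * w 0 i.
  have := congr1 (fun z : 'rV[R[i]]_n => z 0 i) wM; rewrite !mxE => <-.
  by apply: eq_bigr => j _; rewrite !mxE.
have Mji (j i : ordinal n) : M j i = - M i j.
  by have := congr1 (fun N : (matrix R n n) => N i j) M_skew; rewrite !mxE.
(* [eigenvalue] provides a left eigenvector; by skewness its transpose is a
   right eigenvector for the opposite eigenvalue, whence the signs below. *)
have Ma : M *m a = y *: b - x *: a.
  apply/matrixP => i j; rewrite ord1 !mxE.
  have /(congr1 (@complex.Re R)) := wME i; rewrite raddf_sum /= wE /= => h.
  rewrite -opprB -h -sumrN; apply: eq_bigr => k _.
  by rewrite wE /= Mji; ring.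
have Mb : M *m b = - x *: b - y *: a.
  apply/matrixP => i j; rewrite ord1 !mxE.
  have /(congr1 (@complex.Im R)) := wME i; rewrite raddf_sum /= wE /= => h.
  rewrite mulNr -opprD -h -sumrN; apply: eq_bigr => k _.
  by rewrite wE /= Mji; ring.
have x0 : x = 0.
  (* The cross terms cancel in the sum of <Ma, a> = 0 and <Mb, b> = 0. *)
  have := dot_skew0 M_skew a; have := dot_skew0 M_skew b.
  rewrite Ma Mb -!scaleNr !dotDl !dotZl (dotC b a) => hb ha.
  have /eqP : x * (dot a a + dot b b) = 0 by lra.
  rewrite mulf_eq0 paddr_eq0 ?dot_ge0 // !dot_eq0.
  move=> /orP [/eqP //|/andP [/eqP a0 /eqP b0]].
  by case/eqP: w0; apply/matrixP => i j; rewrite ord1 wE a0 b0 !mxE.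
have normE : ComplexField.Normc.normc (Complex x y) ^+ 2 = y ^+ 2.
  by rewrite x0 /= expr0n add0r sqr_sqrtr ?sqr_ge0.
have MMa : M *m (M *m a) = - y ^+ 2 *: a.
  rewrite Ma x0 scale0r subr0 -scalemxAr Mb x0 oppr0 scale0r sub0r.
  by rewrite scalerN scalerA expr2 scaleNr.
have MMb : M *m (M *m b) = - y ^+ 2 *: b.
  rewrite Mb x0 oppr0 scale0r sub0r mulmxN -scalemxAr Ma x0 scale0r subr0.
  by rewrite scalerA expr2 scaleNr.
rewrite normE; have [a0|] := eqVneq a 0; last by exists a.
exists b => //; apply: contra_neq w0 => b0; apply/matrixP => i j.
by rewrite ord1 wE a0 b0 !mxE.
Qed.

(** M is normal over the complex numbers, hence unitarily diagonalizable, and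
    the unitary change of basis preserves norms: the eigenvalue of largest
    modulus bounds the operator norm of M. *)
Lemma exists_top_eigen (R : realType) (n : nat) (M : 'M[R]_n)
    (M_skew : M^T = - M) : (0 < n)%N ->
  exists2 l : R[i], eigenvalue (map_mx (real_complex R) M) l &
  forall v : 'cV[R]_n, dot (M *m v) (M *m v)
                       <= ComplexField.Normc.normc l ^+ 2 * dot v v.
Proof.
move=> n_gt0; set MC := map_mx (real_complex R) M.
have cMC : map_mx Num.conj MC = MC.
  by apply/matrixP => i j; rewrite !mxE; apply: conjc_real.
have MCT : MC^T = - MC.
  by rewrite map_trmx M_skew map_mxN.
have nMC : MC \is normalmx.
  by apply/normalmxP; rewrite MCT map_mxN cMC mulmxN mulNmx.
have [P [d [Pu PU MCE]]] : exists (P : 'M[R[i]]_n) (d : 'rV[R[i]]_n),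
    [/\ P \is unitarymx, P \in unitmx & MC = invmx P *m diag_mx d *m P].
  exists (spectralmx MC), (spectral_diag MC); split.
  - exact: spectral_unitarymx.
  - exact: spectral_unit.
  - exact/orthomx_spectralP.
pose nd i : R := ComplexField.Normc.normc (d 0 i).
pose i0 := [arg max_(i > Ordinal n_gt0) nd i]%O.
exists (d 0 i0).
  apply/eigenvalueP; exists (row i0 P).
    rewrite MCE -row_mul !mulmxA mulmxV // mul1mx row_mul row_diag_mx.
    by rewrite -scalemxAl -rowE.
  rewrite rowE; apply/eqP => /(congr1 (mulmxr (invmx P))) /=.
  rewrite mulmxK // mul0mx => /(congr1 (fun z : 'rV[R[i]]_n => z 0 i0)).
  by rewrite !mxE !eqxx => /eqP; rewrite oner_eq0.
move=> v; pose x : 'rV[R[i]]_n := map_mx (real_complex R) v^T.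
have xP : x *m P^t* *m P = x by rewrite mulmxKtV.
set y := x *m P^t* in xP.
have dotC_E (u : 'cV[R]_n) :
    let z : 'rV[R[i]]_n := map_mx (real_complex R) u^T in
    real_complex R (dot u u) = (z *m z^t* ) 0 0.
  rewrite /= dotE !mxE rmorph_sum; apply: eq_bigr => i _.
  rewrite !mxE [LHS]rmorphM /=; congr (_ * _).
  exact: esym (conjc_real _).
have parseval (z : 'rV[R[i]]_n) :
    (z *m P *m (z *m P)^t* ) 0 0 = \sum_i `|z 0 i| ^+ 2.
  rewrite trmx_mul map_mxM mulmxA mulmxtVK // mxE.
  by apply: eq_bigr => i _; rewrite !mxE normCK.
have norm_v : real_complex R (dot v v) = \sum_i `|y 0 i| ^+ 2.
  by rewrite dotC_E -/x -xP parseval.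
have norm_Mv : real_complex R (dot (M *m v) (M *m v)) =
    \sum_i `|d 0 i * y 0 i| ^+ 2.
  (* The diagonalization acts on rows, and (- Mv)^T = v^T M. *)
  have -> : dot (M *m v) (M *m v) = dot (- (M *m v)) (- (M *m v)).
    by rewrite -scaleN1r dotZl dotZr; ring.
  rewrite dotC_E -mulNmx -M_skew trmx_mul trmxK map_mxM -/x -/MC MCE -xP.
  rewrite !mulmxA mulmxK // parseval.
  by apply: eq_bigr => i _; rewrite mul_mx_diag mxE mulrC.
have normd i : `|d 0 i| = real_complex R (nd i).
  by rewrite normc_def /nd; case: (d 0 i).
suff : real_complex R (dot (M *m v) (M *m v)) <=
       real_complex R (nd i0 ^+ 2 * dot v v) by rewrite lecR.
rewrite [X in _ <= X]rmorphM [X in _ <= _ * X]norm_v norm_Mv mulr_sumr.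
apply: ler_sum => i _; rewrite normrM exprMn ler_wpM2r ?exprn_ge0 //.
rewrite normd -!rmorphXn lecR.
have nd_ge0 k : 0 <= nd k.
  by rewrite /nd; case: (d 0 k) => ? ?; apply: sqrtr_ge0.
rewrite lerXn2r ?nnegrE //.
rewrite /i0; have [k _ h] := arg_maxP nd (isT : xpredT (Ordinal n_gt0)).
by apply: h.
Qed.

Lemma dot_skew_eigen (R : realType) (n : nat) (M : 'M[R]_n)
    (M_skew : M^T = - M) (s : R) (v : 'cV[R]_n) :
  M *m (M *m v) = - s *: v -> dot (M *m v) (M *m v) = s * dot v v.
Proof. by move=> h; rewrite (dot_skew M_skew) h dotZr mulNr opprK. Qed.

(** The supremum defining the spectral radius is attained at the eigenvalue of
    [exists_top_eigen]: any other eigenvalue z has a real v with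
    |Mv| = |z| |v|, which the operator norm bound compares with it. *)
Lemma spectral_radius_top_eigen (R : realType) (n : nat) (M : 'M[R]_n)
    (M_skew : M^T = - M) : (0 < n)%N ->
  [/\ 0 <= spectral_radius M,
      forall v : 'cV[R]_n, dot (M *m v) (M *m v)
                           <= spectral_radius M ^+ 2 * dot v v
    & exists2 v : 'cV[R]_n, v != 0 &
        M *m (M *m v) = - spectral_radius M ^+ 2 *: v].
Proof.
move=> /(exists_top_eigen M_skew) [l l_eig l_top].
have nc_ge0 (z : R[i]) : 0 <= ComplexField.Normc.normc z.
  by case: z => ? ?; apply: sqrtr_ge0.
have -> : spectral_radius M = ComplexField.Normc.normc l.
  have l_ub : ubound [set ComplexField.Normc.normc z | z in
      [set z : R[i] | eigenvalue (map_mx (real_complex R) M) z]]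
      (ComplexField.Normc.normc l).
    move=> _ [z /(skew_eigen M_skew) [v v0 /(dot_skew_eigen M_skew) hv] <-].
    rewrite -(@ler_pXn2r _ 2) ?nnegrE // -(ler_pM2r (dot_gt0 v0)) -hv.
    exact: l_top.
  apply/eqP; rewrite eq_le; apply/andP; split.
    by apply: ge_sup l_ub; exists (ComplexField.Normc.normc l), l.
  by apply: ub_le_sup; [exists (ComplexField.Normc.normc l) | exists l].
by split => //; apply: (skew_eigen M_skew).
Qed.

(** * One double step of restarted Anderson acceleration *)

Lemma aa_stepE (R : realType) (n : nat) (M : 'M[R]_n)
    (M_skew : M^T = - M)
    (v : 'cV[R]_n) (u := dot v v) (p := dot (M *m v) (M *m v)) :
  v != 0 -> aa_step M v = (p / (u + p)) *: (M *m v)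
                          + (u / (u + p)) *: (M *m (M *m v)).
Proof.
move=> v0; rewrite /aa_step (negPf v0).
have u0 : 0 < u := dot_gt0 v0; have p0 : 0 <= p := dot_ge0 _.
have alphaE : aa_alpha M v = u / (u + p).
  rewrite /aa_alpha mulmxBl mul1mx -scaleN1r !(dotDl, dotDr, dotZl, dotZr).
  rewrite (dotC v (M *m v)) (dot_skew0 M_skew) -/u -/p; congr (_ / _); ring.
have -> : p / (u + p) = 1 - aa_alpha M v.
  by clear M_skew; rewrite alphaE; field; lra.
rewrite -alphaE -mulmxA !mulmxBl mul1mx -scalemxAl mulmxBl mul1mx.
rewrite !mulmxBr -scalemxAr mulmxBr scalerBr scalerBl scale1r.
by rewrite opprB addrA addrAC.
Qed.

Lemma dot_aa_step (R : realType) (n : nat) (M : 'M[R]_n)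
    (M_skew : M^T = - M)
    (v : 'cV[R]_n) (u := dot v v) (p := dot (M *m v) (M *m v))
    (q := dot (M *m (M *m v)) (M *m (M *m v))) :
  v != 0 ->
  dot (aa_step M v) (aa_step M v) = (p ^+ 3 + u ^+ 2 * q) / (u + p) ^+ 2.
Proof.
move=> v0; rewrite (aa_stepE M_skew) // !(dotDl, dotDr, dotZl, dotZr).
rewrite (dotC (M *m v)) (dot_skew0 M_skew) -/u -/p -/q.
have u0 : 0 < u := dot_gt0 v0; have p0 : 0 <= p := dot_ge0 _.
by clear M_skew; field; lra.
Qed.

(** With q at its largest value s p, the left-hand side need not be monotone in p
    for large s, so the bound does not follow by substituting p = s u. It holds because, after
    clearing denominators, the difference of the two sides is divisible by
    s u - p with a cofactor whose coefficients are nonnegative. *)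
Lemma aa_ratio_le (R : realType) (s u p q : R) :
  0 <= s -> 0 < u -> 0 <= p -> p <= s * u -> q <= s * p ->
  (p ^+ 3 + u ^+ 2 * q) / (u + p) ^+ 2 <= s ^+ 2 / (1 + s) * u.
Proof.
move=> s0 u0 p0 ps qs.
have h : p ^+ 3 + u ^+ 2 * q <= p ^+ 3 + u ^+ 2 * (s * p).
  by rewrite lerD2l ler_wpM2l // exprn_ge0 // ltW.
rewrite ler_pdivrMr ?exprn_gt0 ?ltr_wpDr //; apply: le_trans h _.
have -> : s ^+ 2 / (1 + s) * u * (u + p) ^+ 2
  = s ^+ 2 * (u + p) ^+ 2 * u / (1 + s).
  by field; lra.
rewrite ler_pdivlMr; last lra.
rewrite -subr_ge0.
have -> : s ^+ 2 * (u + p) ^+ 2 * u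
    - (p ^+ 3 + u ^+ 2 * (s * p)) * (1 + s)
  = (s * u - p) * ((1 + s) * p ^+ 2 + s * p * u + s * u ^+ 2) by ring.
by rewrite mulr_ge0 ?subr_ge0 // !addr_ge0 ?mulr_ge0 ?exprn_ge0 // ?ltW //; lra.
Qed.

Lemma aa_ratio_top (R : realType) (s u : R) : 0 <= s -> 0 < u ->
  ((s * u) ^+ 3 + u ^+ 2 * (s * (s * u))) / (u + s * u) ^+ 2
  = s ^+ 2 / (1 + s) * u.
Proof. by move=> s0 u0; field; nra. Qed.

Lemma aa_residual_double (R : realType) n (M : 'M[R]_n) r0 j :
  aa_residual M r0 j.*2 = iter j (aa_step M) r0 /\
  aa_residual M r0 j.*2.+1 = M *m iter j (aa_step M) r0.
Proof.
elim: j => [//|j [IH1 IH2]].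
have E : aa_residual M r0 j.+1.*2 = iter j.+1 (aa_step M) r0.
  by rewrite doubleS iterS -IH1 /= odd_double.
by split=> //; rewrite -E doubleS /= odd_double.
Qed.

(** * Root-convergence factors of geometrically bounded residuals *)

Lemma powR_inv_nat_cvg1 (R : realType) (C : R) : 0 < C ->
  C `^ (k%:R^-1) @[k --> \oo] --> (1 : R).
Proof.
move=> c0.
have inv0 : (k%:R^-1 : R) @[k --> \oo] --> (0 : R).
  by rewrite -[_ --> _]cvg_shiftS; exact: cvg_harmonic.
have -> : (fun k : nat => C `^ (k%:R^-1)) = (fun k => expR (k%:R^-1 * ln C)).
  by apply/funext => k; rewrite /powR gt_eqF.
rewrite -[X in _ --> X]expR0 -[X in _ --> expR X](mul0r (ln C)).
apply: continuous_cvg; first exact: continuous_expR.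
exact: cvgMr_tmp inv0.
Qed.

Lemma powR_geometric_root_cvg (R : realType) (C g : R) : 0 < C -> 0 < g ->
  (C * g ^+ k) `^ (k%:R^-1) @[k --> \oo] --> g.
Proof.
move=> c0 g0.
have : C `^ (k%:R^-1) * g @[k --> \oo] --> 1 * g.
  exact: cvgMr_tmp (powR_inv_nat_cvg1 c0).
rewrite mul1r; apply: cvg_trans; apply: near_eq_cvg; near=> k.
rewrite powRM ?exprn_ge0 ?ltW // -powR_mulrn ?ltW // -powRrM.
rewrite divff ?powRr1 ?ltW //.
by rewrite pnatr_eq0 -lt0n; near: k; exact: nbhs_infty_gt.
Unshelve. all: by end_near. Qed.

Lemma root_factor_le (R : realType) n (r : nat -> 'cV[R]_n) (C g : R) :
  0 < C -> 0 < g -> (forall k, l2norm (r k) <= C * g ^+ k) ->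
  (root_factor r <= g%:E)%E.
Proof.
move=> c0 g0 h; apply/lee_addgt0Pr => e e0.
apply: ge_ereal_inf; eexists.
  exists [set k : nat | (C * g ^+ k) `^ (k%:R^-1) <= g + e]; last by [].
  by apply: cvgr_le _ (powR_geometric_root_cvg c0 g0) _ _; rewrite ltrDl.
apply: ge_ereal_sup => _ [k /= hk <-].
rewrite -EFinD lee_fin; apply: le_trans hk.
apply: ge0_ler_powR; rewrite ?nnegrE ?invr_ge0 ?sqrtr_ge0 ?ler0n //.
by rewrite mulr_ge0 ?exprn_ge0 ?(ltW c0) ?(ltW g0).
Unshelve. all: by end_near. Qed.

Lemma root_factor_ge (R : realType) n (r : nat -> 'cV[R]_n) (c g : R) :
  0 < c -> 0 < g -> (forall k, c * g ^+ k <= l2norm (r k)) ->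
  (g%:E <= root_factor r)%E.
Proof.
move=> c0 g0 h; apply: le_ereal_inf_tmp => _ [V V_oo <-].
apply/lee_subgt0Pr => e e0.
have : \forall k \near \oo, V k /\ g - e <= (c * g ^+ k) `^ (k%:R^-1).
  near=> k; split; first by near: k.
  near: k.
  by apply: cvgr_ge _ (powR_geometric_root_cvg c0 g0) _ _; rewrite gtrBl.
move=> /filter_ex [k [Vk hk]].
apply: le_ereal_sup_tmp; exists (l2norm (r k) `^ (k%:R^-1))%:E.
  by exists k.
rewrite -EFinB lee_fin; apply: le_trans hk _.
apply: ge0_ler_powR; rewrite ?nnegrE ?invr_ge0 ?sqrtr_ge0 ?ler0n //.
by rewrite mulr_ge0 ?exprn_ge0 ?(ltW c0) ?(ltW g0).
Unshelve. all: by end_near. Qed.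

(** The Euclidean norm is equivalent to the sup norm, which defines the
    convergence of vectors: |v|_sup <= |v|_2 <= n |v|_sup. *)
Lemma l2norm_cvg0 (R : realType) n (r : nat -> 'cV[R]_n) :
  r k @[k --> \oo] --> (0 : 'cV[R]_n) <-> l2norm (r k) @[k --> \oo] --> (0:R).
Proof.
have le1 (v : 'cV[R]_n) : `|v| <= l2norm v.
  rewrite [`|v|]mx_normrE; apply: bigmax_le => [|[i j] _].
    exact: sqrtr_ge0.
  rewrite ord1 /= -sqrtr_sqr; apply: ler_wsqrtr.
  rewrite /dot (bigD1 i) //= -expr2 lerDl.
  by apply: sumr_ge0 => k _; rewrite -expr2 sqr_ge0.
have le2 (v : 'cV[R]_n) : l2norm v <= n%:R * `|v|.
  have v_le i : `|v i 0| <= `|v|.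
    rewrite [leRHS]mx_normrE.
    exact: (le_bigmax 0 (fun ij => `|v ij.1 ij.2|) (i, 0)).
  rewrite -(@ler_pXn2r _ 2) ?nnegrE ?mulr_ge0 ?sqrtr_ge0 //.
  rewrite sqr_sqrtr; last by apply: sumr_ge0 => k _; rewrite -expr2 sqr_ge0.
  apply: (@le_trans _ _ (\sum_(i < n) `|v| ^+ 2)).
    apply: ler_sum => i _; rewrite -expr2 -real_normK ?num_real //.
    by rewrite lerXn2r ?nnegrE.
  rewrite sumr_const card_ord -[leLHS]mulr_natl exprMn ler_wpM2r ?exprn_ge0 //.
  by rewrite -natrX ler_nat; case: (n) => // m; rewrite -mulnn leq_pmulr.
split => h.
  apply: (@squeeze_cvgr _ _ _ _ (fun=> 0) (fun k => n%:R * `|r k|));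
    last 2 first.
  - exact: cvg_cst.
  - rewrite -(mulr0 n%:R) -(@normr0 _ 'cV[R]_n).
    by apply: cvgMl_tmp; exact: cvg_norm.
  by near=> k; rewrite sqrtr_ge0 le2.
apply/norm_cvg0P.
apply: (@squeeze_cvgr _ _ _ _ (fun=> 0) (fun k => l2norm (r k))) => //.
  2: exact: cvg_cst.
by near=> k; rewrite normr_ge0 le1.
Unshelve. all: by end_near. Qed.

(** Constants disappear under k-th roots, so the upper bound caps every factor
    at g, and the lower bound makes the start v attain it. *)
Lemma worst_factor_geometric (R : realType) n
    (res : 'cV[R]_n -> nat -> 'cV[R]_n) (C g : R) (v : 'cV[R]_n) :
  0 < C -> 0 < g -> v != 0 ->
  (forall r0 k, l2norm (res r0 k) <= C * l2norm r0 * g ^+ k) ->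
  (forall k, l2norm v * g ^+ k <= l2norm (res v k)) ->
  is_worst_factor res g%:E.
Proof.
move=> C0 g0 v0 res_le res_ge.
have le_g r0 : r0 != 0 -> (root_factor (res r0) <= g%:E)%E.
  move=> r00; apply: root_factor_le (res_le r0) => //.
  by rewrite mulr_gt0 ?l2norm_gt0.
split; last by move=> _ [r0 r00 <-]; exact: le_g.
exists v => //; apply/eqP; rewrite eq_le le_g //=.
by apply: root_factor_ge res_ge; rewrite ?l2norm_gt0.
Qed.

(** When g >= 1, the lower bound keeps the residuals started at v away from 0. *)
Lemma geometric_cvg0_iff (R : realType) n
    (res : 'cV[R]_n -> nat -> 'cV[R]_n) (C g : R) (v : 'cV[R]_n) :
  0 < g -> v != 0 ->
  (forall r0 k, l2norm (res r0 k) <= C * l2norm r0 * g ^+ k) ->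
  (forall k, l2norm v * g ^+ k <= l2norm (res v k)) ->
  (forall r0, res r0 k @[k --> \oo] --> (0 : 'cV[R]_n)) <-> g < 1.
Proof.
move=> g0 v0 res_le res_ge; split => [cvg0|g1 r0].
  rewrite ltNge; apply/negP => g1.
  have : l2norm v <= 0.
    apply: (cvgr_to_ge (iffLR (l2norm_cvg0 _) (cvg0 v))).
    near=> k; apply: le_trans (res_ge k).
    by rewrite ler_peMr ?exprn_ege1 ?sqrtr_ge0.
  by rewrite leNgt l2norm_gt0.
apply/l2norm_cvg0.
apply: (@squeeze_cvgr _ _ _ _ (fun=> 0) (fun k => C * l2norm r0 * g ^+ k)).
- by near=> k; apply/andP; split; [exact: sqrtr_ge0 | exact: res_le].
- exact: cvg_cst.
- rewrite -(mulr0 (C * l2norm r0)); apply: cvgMl_tmp.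
  by apply: cvg_expr; rewrite ger0_norm // ltW.
Unshelve. all: by end_near. Qed.

(** * The worst-case factor of restarted Anderson acceleration *)

(** The polynomial 1 + s - s^2 in s = x^2 factors through the golden ratio and
    its conjugate, and the conjugate factor is positive for s >= 0. *)
Lemma lt_sqrt_golden_ratio (R : realType) (x : R) : 0 <= x ->
  (x < Num.sqrt (2%:R^-1 * (1 + Num.sqrt 5%:R))) = (x ^+ 4 < 1 + x ^+ 2).
Proof.
move=> x0.
set f := Num.sqrt 5%:R.
have f0 : 0 < f by rewrite sqrtr_gt0.
have f2 : f ^+ 2 = 5 by rewrite sqr_sqrtr.
have d0 : 0 <= 2%:R^-1 * (1 + f) by rewrite mulr_ge0 //; lra.
rewrite -(@ltr_pXn2r _ 2) ?nnegrE ?sqrtr_ge0 // sqr_sqrtr //.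
have -> : x ^+ 4 = (x ^+ 2) ^+ 2 by rewrite -exprM.
have : 0 <= x ^+ 2 by rewrite exprn_ge0.
move: (x ^+ 2) => s s0.
rewrite -subr_gt0 -[RHS]subr_gt0.
have -> : 1 + s - s ^+ 2 = (2^-1 * (1 + f) - s) * (s + 2^-1 * (f - 1)).
  by lra.
rewrite pmulr_lgt0 //; nra.
Qed.

Definition aa_factor (R : realType) (x : R) : R :=
  x / (1 + x ^+ 2) `^ (4%:R^-1).

Lemma aa_factor4 (R : realType) (x : R) :
  aa_factor x ^+ 4 = x ^+ 4 / (1 + x ^+ 2).
Proof.
have h : 0 < 1 + x ^+ 2 by rewrite ltr_pwDl // sqr_ge0.
rewrite expr_div_n; congr (_ / _).
by rewrite -(powR_mulrn 4 (powR_ge0 _ _)) -powRrM mulVf ?powRr1 ?ltW.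
Qed.

Lemma aa_factor_gt0 (R : realType) (rho : R) : 0 < rho -> 0 < aa_factor rho.
Proof.
by move=> rho_gt0; rewrite divr_gt0 // powR_gt0 // ltr_pwDl // sqr_ge0. Qed.

Lemma aa_factor_lt (R : realType) (rho : R) : 0 < rho -> aa_factor rho < rho.
Proof.
move=> rho_gt0; rewrite -(@ltr_pXn2r _ 4) ?nnegrE ?ltW ?aa_factor_gt0 //.
rewrite aa_factor4; have s0 : 0 < rho ^+ 2 by rewrite exprn_gt0.
by rewrite ltr_pdivrMr ?ltr_pwDl ?ltW // ltr_pMr ?exprn_gt0 // ltrDl.
Qed.

Lemma aa_factor_lt1 (R : realType) (rho : R) : 0 < rho ->
  (aa_factor rho < 1) = (rho < Num.sqrt (2%:R^-1 * (1 + Num.sqrt 5%:R))).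
Proof.
move=> rho_gt0; rewrite lt_sqrt_golden_ratio ?ltW //.
rewrite -(@ltr_pXn2r _ 4) ?nnegrE ?ltW ?aa_factor_gt0 //.
by rewrite aa_factor4 expr1n ltr_pdivrMr ?mul1r // ltr_pwDl // sqr_ge0.
Qed.

(** * Two-sided bounds on the residuals *)

Lemma l2norm_iter_le (R : realType) n (f : 'cV[R]_n -> 'cV[R]_n) (c : R) :
  0 <= c ->
  (forall v, l2norm (f v) <= c * l2norm v) ->
  forall k v, l2norm (iter k f v) <= c ^+ k * l2norm v.
Proof.
move=> c0 f_le; elim=> [|k IH] v; first by rewrite mul1r.
by rewrite iterS exprS -mulrA (le_trans (f_le _)) // ler_wpM2l.
Qed.

Lemma l2norm_iter_eq (R : realType) n (E : 'cV[R]_n -> Prop)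
    (f : 'cV[R]_n -> 'cV[R]_n) (c : R) :
  (forall v, E v -> E (f v) /\ l2norm (f v) = c * l2norm v) ->
  forall k v, E v ->
    E (iter k f v) /\ l2norm (iter k f v) = c ^+ k * l2norm v.
Proof.
move=> f_eq; elim=> [|k IH] v Ev; first by rewrite mul1r.
have [Ek nk] := IH v Ev; have [ES nS] := f_eq _ Ek.
by split=> //; rewrite iterS nS nk exprS mulrA.
Qed.

Section Residuals.
Variables (R : realType) (n : nat) (M : 'M[R]_n).
Hypothesis M_skew : M^T = - M.
Variable rho : R.
Hypothesis rho_gt0 : 0 < rho.

Section Bound.
Hypothesis M_le : forall v : 'cV[R]_n,
  dot (M *m v) (M *m v) <= rho ^+ 2 * dot v v.

Lemma l2norm_mulmx_le (v : 'cV[R]_n) : l2norm (M *m v) <= rho * l2norm v.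
Proof. by apply: ler_l2norm; [exact: ltW | exact: M_le]. Qed.

Lemma l2norm_aa_step_le (v : 'cV[R]_n) :
  l2norm (aa_step M v) <= aa_factor rho ^+ 2 * l2norm v.
Proof.
apply: ler_l2norm; first exact: sqr_ge0.
have [->|v0] := eqVneq v 0.
  by rewrite /aa_step eqxx dot0 mulr0.
rewrite -exprM aa_factor4 (dot_aa_step M_skew) //.
rewrite (exprM rho 2 2); apply: aa_ratio_le;
  by rewrite ?sqr_ge0 ?dot_gt0 ?dot_ge0 ?M_le.
Qed.

(** An odd-indexed residual is M times the preceding one, so the bound on double
    steps loses there one factor rho in place of g; the constant rho / g >= 1
    absorbs this. *)
Lemma aa_residual_le (r0 : 'cV[R]_n) k :
  l2norm (aa_residual M r0 k)
  <= rho / aa_factor rho * l2norm r0 * aa_factor rho ^+ k.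
Proof.
have g0 := aa_factor_gt0 rho_gt0; have g_lt := aa_factor_lt rho_gt0.
set g := aa_factor rho in g0 g_lt *.
have even_le j : l2norm (iter j (aa_step M) r0) <= g ^+ j.*2 * l2norm r0.
  rewrite -mul2n exprM; apply: l2norm_iter_le => [|v]; first exact: sqr_ge0.
  exact: l2norm_aa_step_le.
rewrite -(odd_double_half k); have [Eeven Eodd] := aa_residual_double M r0 k./2.
case: (odd k); rewrite ?add0n ?add1n ?Eeven ?Eodd.
  apply: le_trans (l2norm_mulmx_le _) _.
  apply: le_trans (ler_wpM2l (ltW rho_gt0) (even_le _)) _.
  rewrite exprS le_eqVlt; apply/orP; left; apply/eqP.
  by clear M_skew; field; lra.
apply: le_trans (even_le _) _.
rewrite [leRHS]mulrC ler_wpM2l ?exprn_ge0 ?(ltW g0) //.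
by rewrite ler_peMl ?sqrtr_ge0 // ler_pdivlMr // mul1r ltW.
Qed.

Lemma fp_residual_le (r0 : 'cV[R]_n) k :
  l2norm (fp_residual M r0 k) <= 1 * l2norm r0 * rho ^+ k.
Proof.
rewrite mul1r mulrC; apply: l2norm_iter_le => [|v]; first exact: ltW.
exact: l2norm_mulmx_le.
Qed.

End Bound.

(** The eigenspace of M^2 for its most negative eigenvalue, when [rho] is the
    spectral radius of M; being real, it replaces the two complex eigenspaces
    of M for the conjugate eigenvalues of modulus [rho]. *)
Definition top_eigen (v : 'cV[R]_n) := M *m (M *m v) = - rho ^+ 2 *: v.

Lemma mulmx_top_eigen (v : 'cV[R]_n) :
  top_eigen v -> top_eigen (M *m v) /\ l2norm (M *m v) = rho * l2norm v.
Proof.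
rewrite /top_eigen => Ev; split; first by rewrite Ev -scalemxAr.
by apply: eq_l2norm; rewrite ?ltW // (dot_skew_eigen M_skew Ev).
Qed.

Lemma aa_step_top_eigen (v : 'cV[R]_n) : top_eigen v ->
  top_eigen (aa_step M v) /\
  l2norm (aa_step M v) = aa_factor rho ^+ 2 * l2norm v.
Proof.
rewrite /top_eigen => Ev; have [->|v0] := eqVneq v 0.
  rewrite /aa_step eqxx !mulmx0 scaler0; split=> //.
  by rewrite /l2norm dot0 sqrtr0 mulr0.
split.
  rewrite (aa_stepE M_skew) // !mulmxDr -!scalemxAr Ev -!scalemxAr Ev.
  by rewrite scalerDr !scalerA; congr (_ *: _ + _ *: _); ring.
apply: eq_l2norm; first exact: sqr_ge0.
rewrite -exprM aa_factor4 (dot_aa_step M_skew) //.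
have [EMv _] := mulmx_top_eigen Ev.
rewrite (dot_skew_eigen M_skew EMv) (dot_skew_eigen M_skew Ev).
by rewrite aa_ratio_top ?sqr_ge0 ?dot_gt0 // -exprM.
Qed.

Lemma aa_residual_ge (v : 'cV[R]_n) k : top_eigen v ->
  l2norm v * aa_factor rho ^+ k <= l2norm (aa_residual M v k).
Proof.
move=> Ev; have [Eeven Eodd] := aa_residual_double M v k./2.
have [Ek] := l2norm_iter_eq aa_step_top_eigen k./2 Ev.
rewrite -exprM mul2n => nk.
rewrite -[k in _ ^+ k]odd_double_half -[k in aa_residual M v k]odd_double_half.
case: (odd k); rewrite ?add0n ?add1n ?Eeven ?Eodd; last by rewrite nk mulrC.
have [_ ->] := mulmx_top_eigen Ek; rewrite nk exprS mulrC -mulrA.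
have g_ge0 := ltW (aa_factor_gt0 rho_gt0).
by rewrite ler_wpM2r ?mulr_ge0 ?exprn_ge0 ?sqrtr_ge0 // ltW // aa_factor_lt.
Qed.

Lemma fp_residual_ge (v : 'cV[R]_n) k : top_eigen v ->
  l2norm v * rho ^+ k <= l2norm (fp_residual M v k).
Proof.
move=> Ev.
by have [_ ->] := l2norm_iter_eq mulmx_top_eigen k Ev; rewrite mulrC.
Qed.

End Residuals.

Theorem corollary5p4 (R : realType) (n : nat) (M : 'M[R]_n)
    (n_even : ~~ odd n) (M_neq0 : M != 0) (M_skew : M^T = - M) :
  (exists wAA wFP : R,
    [/\ is_worst_factor (aa_residual M) wAA%:E,
        is_worst_factor (fp_residual M) wFP%:E,
        wAA = spectral_radius M / (1 + spectral_radius M ^+ 2) `^ (4%:R^-1),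
        spectral_radius M / (1 + spectral_radius M ^+ 2) `^ (4%:R^-1)
          < spectral_radius M
      & spectral_radius M = wFP]) /\
  ((forall r0 : 'cV[R]_n, aa_residual M r0 k @[k --> \oo] --> (0 : 'cV[R]_n)) <->
   spectral_radius M < Num.sqrt (2%:R^-1 * (1 + Num.sqrt 5%:R))).
Proof.
have n_gt0 : (0 < n)%N.
  rewrite lt0n; apply: contra_neq M_neq0 => n0; apply/matrixP => i.
  by have : (i < 0)%N by rewrite -[X in (_ < X)%N]n0 ltn_ord.
have [rho_ge0 M_le [v v0 Ev]] := spectral_radius_top_eigen M_skew n_gt0.
have rho_gt0 : 0 < spectral_radius M.
  rewrite lt_def rho_ge0 andbT; apply: contra_neq M_neq0 => rho0.
  apply/matrixP => i j; rewrite mxE.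
  have /eqP : dot (M *m delta_mx j 0) (M *m delta_mx j 0) = 0.
    by apply: le_anti; rewrite dot_ge0 (le_trans (M_le _)) // rho0 expr0n mul0r.
  by rewrite dot_eq0 -colE => /eqP/matrixP/(_ i 0); rewrite !mxE.
have g0 := aa_factor_gt0 rho_gt0.
split; last first.
  rewrite -aa_factor_lt1 //.
  apply: geometric_cvg0_iff g0 v0 (aa_residual_le M_skew rho_gt0 M_le) _ => k.
  exact: aa_residual_ge.
exists (aa_factor (spectral_radius M)), (spectral_radius M); split=> //.
- apply: worst_factor_geometric v0 (aa_residual_le M_skew rho_gt0 M_le) _ => //.
    exact: divr_gt0.
  by move=> k; exact: aa_residual_ge.
- apply: worst_factor_geometric v0 (fp_residual_le rho_gt0 M_le) _ => //.
  by move=> k; exact: fp_residual_ge.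
- exact: aa_factor_lt.
Qed.
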